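(* Let $p>1$ and $0<u<p$ be real and $d$ a positive integer. For every integer $n\ge0$, the probability that a partition $\lambda$ chosen from $P_{d,u}$ has size $|\lambda|=n$ equals \[ \frac{u^n}{p^n}\,\frac{(u/p)_d\,(1/p)_{d+n-1}}{(1/p)_{d-1}\,(1/p)_n}. \]
   Context: Write $(x)_i=(1-x)(1-x/p)\cdots(1-x/p^{i-1})$ (with $(x)_0=1$). For a partition $\lambda$: $|\lambda|=\sum\lambda_i$, $m_i(\lambda)$ is the number of parts equal to $i$, $\lambda_i'$ is the length of the $i$-th column of its diagram, and $r=\lambda_1'$ its number of parts. The probability measure $P_{d,u}$ on partitions is $P_{d,u}(\lambda)=\frac{u^{|\lambda|}}{p^{\sum_i(\lambda_i')^2}\prod_i (1/p)_{m_i(\lambda)}}\prod_{i=1}^d(1-u/p^i)\prod_{i=d-r+1}^d(1-1/p^i)$ if $r\le d$, and $0$ otherwise. *)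

(* Defs.v *)
From HB Require Import structures.
From mathcomp Require Import all_boot all_order all_algebra.
From mathcomp Require Import all_classical all_reals all_analysis.

Set Implicit Arguments.
Unset Strict Implicit.
Unset Printing Implicit Defensive.

Import Order.TTheory GRing.Theory Num.Theory.

Local Open Scope classical_set_scope.
Local Open Scope ring_scope.

Definition is_partition (s : seq nat) : bool := sorted geq s && (0%N \notin s).

Record intpart := Intpart {
  parts :> seq nat;
  _ : is_partition parts
}.

HB.instance Definition _ := [isSub for parts].
HB.instance Definition _ := [Countable of intpart by <:].

Definition psize (l : intpart) : nat := sumn l.

Definition mult (l : intpart) (i : nat) : nat := count_mem i l.

(* column lengths of the Young diagram whose rows are the parts; columns are
   numbered from 1 *)
Definition column (l : intpart) (i : nat) : nat := count (leq i) l.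

Definition nparts (l : intpart) : nat := column l 1.

Definition largest (l : intpart) : nat := head 0%N l.

Section Measure.
Variable R : realType.

Definition poch (p x : R) (i : nat) : R := \prod_(0 <= j < i) (1 - x / p ^+ j).

(* The sum and the product over all i >= 1 are cut at the largest part, beyond
   which column l i = mult l i = 0. *)
Definition Pmass (p u : R) (d : nat) (l : intpart) : R :=
  if (nparts l <= d)%N then
    u ^+ psize l
      / (p ^+ (\sum_(1 <= i < (largest l).+1) column l i ^ 2)%N
         * \prod_(1 <= i < (largest l).+1) poch p (1 / p) (mult l i))
    * \prod_(1 <= i < d.+1) (1 - u / p ^+ i)
    * \prod_(d - nparts l + 1 <= i < d.+1) (1 - 1 / p ^+ i)
  else 0.

Definition Pmeas (p u : R) (d : nat) (A : set intpart) : \bar R :=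
  \esum_(l in A) (Pmass p u d l)%:E.

(* esum is a supremum of finite partial sums, hence the expected sum only for
   nonnegative terms. *)
Lemma Pmass_ge0 (p u : R) (d : nat) (l : intpart) :
  1 < p -> 0 < u -> u < p -> 0 <= Pmass p u d l.
Proof.
move=> p1 u0 up; have p0 : 0 < p by apply: lt_trans p1.
have pX i : 1 <= p ^+ i by rewrite exprn_ege1 // ltW.
have pX0 i : 0 < p ^+ i by rewrite exprn_gt0.
have le1 (x : R) i : x <= p -> (0 < i)%N -> 0 <= 1 - x / p ^+ i.
  case: i => // i xp _; rewrite subr_ge0 ler_pdivrMr // mul1r exprS.
  by apply: (le_trans xp); rewrite ler_peMr // ltW.
rewrite /Pmass; case: ifP => // rd.
have prod_ge0 (m n : nat) (F : nat -> R) : (forall i, (m <= i)%N -> 0 <= F i) ->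
    0 <= \prod_(m <= i < n) F i.
  by move=> F0; rewrite big_nat; apply: prodr_ge0 => i /andP[mi _]; exact: F0.
rewrite !mulr_ge0 ?invr_ge0 ?mulr_ge0 ?exprn_ge0 ?(ltW u0) ?(ltW p0) //.
- apply: (prod_ge0) => i _; apply: (prod_ge0) => j _.
  rewrite subr_ge0 div1r ler_pdivrMr // mul1r.
  by apply: (le_trans _ (pX j)); rewrite invf_le1 // ltW.
- by apply: (prod_ge0) => i i1; apply: le1 => //; exact: ltW.
- by apply: (prod_ge0) => i i1; apply: le1; [exact: ltW|rewrite (leq_trans _ i1)// addn1].
Qed.

End Measure.

(* Main.v *)
Require Import Defs.
From HB Require Import structures.
From mathcomp Require Import all_boot all_order all_algebra.
From mathcomp Require Import all_classical all_reals all_analysis.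
From mathcomp Require Import ring zify.

Import Order.TTheory GRing.Theory Num.Theory.

Local Open Scope classical_set_scope.
Local Open Scope ring_scope.

(* Put q = 1/p and let F(d, n) be the sum over the partitions of n with at most
   d parts of q^(sum_i (lambda_i')^2) / prod_i (q)_(m_i) * (q)_d / (q)_(d - r),
   so that the probability is u^n (u/p)_d F(d, n).  Removing the first column,
   of length r, of a Young diagram gives
     F(d, n) = sum_(r >= 1) q^(r^2) [d choose r]_q F(r, n - r),
   and by induction on n the q-Vandermonde identity turns this into
   F(d, n) = q^n [d + n - 1 choose n]_q. *)

(** * Gaussian binomial coefficients *)

Section GaussianBinomial.
Variables (R : comRingType) (q : R).

(** Defined by the q-Pascal rule, hence without division and over any commutative ring; in the last
    branch [k] is [k'.+1]. *)
Fixpoint gbinom (n k : nat) : R :=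
  match n, k with
  | _, 0 => 1
  | 0, _.+1 => 0
  | n'.+1, k'.+1 => gbinom n' k' + q ^+ k * gbinom n' k
  end.

Lemma gbinom0 n : gbinom n 0 = 1.
Proof. by case: n. Qed.

Lemma gbinomS n k :
  gbinom n.+1 k.+1 = gbinom n k + q ^+ k.+1 * gbinom n k.+1.
Proof. by []. Qed.

Lemma gbinom_small n k : (n < k)%N -> gbinom n k = 0.
Proof.
elim: n k => [|n IH] [|k] //= nk.
by rewrite !IH ?mulr0 ?addr0 // ltnW.
Qed.

(* When [m + j < k] the exponent is truncated, but then the first factor of
   the summand vanishes. *)
Lemma gbinom_Vandermonde m n k :
  gbinom (m + n) k =
  \sum_(0 <= j < k.+1) gbinom m (k - j) * gbinom n j * q ^+ (j * (m + j - k)).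
Proof.
elim: m k => [|m IH] k.
  rewrite big_nat_recr // subnn gbinom0 mul1r muln0 expr0 mulr1.
  rewrite big1_seq; first exact: esym (add0r _).
  move=> j /andP[_]; rewrite mem_index_iota => /andP[_ jk].
  by rewrite (@gbinom_small 0) ?mul0r // subn_gt0.
case: k => [|k].
  by rewrite big_nat1 !gbinom0 mul0n expr0 !mulr1.
(* After q-Pascal on the left, the term [j = k.+1] comes from the second sum only and is the last
   term on the right; the others match one by one by q-Pascal on [gbinom m.+1 (k.+1 - j)]. *)
rewrite addSn gbinomS !IH [X in _ + _ * X]big_nat_recr // [RHS]big_nat_recr //.
rewrite mulrDr mulr_sumr addrA -big_split /= !subnn !gbinom0.
congr (_ + _); last first.
  by rewrite !mul1r mulrCA -exprD; congr (_ * q ^+ _); lia.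
rewrite [LHS]big_nat [RHS]big_nat; apply: eq_bigr => j /andP[_]; rewrite ltnS => jk.
rewrite !(subSn jk) 2!mulrDl.
congr (_ + _).
have [mk|mk] := leqP (k - j).+1 m; last by rewrite gbinom_small // !(mul0r, mulr0).
have e : q ^+ k.+1 * q ^+ (j * (m + j - k.+1)) =
         q ^+ (k - j).+1 * q ^+ (j * (m.+1 + j - k.+1)).
  rewrite -!exprD; congr (q ^+ _).
  have -> : (m.+1 + j - k.+1 = (m + j - k.+1).+1)%N by lia.
  by rewrite mulnS; lia.
by rewrite mulrCA e; ring.
Qed.

(** The quotient formula with denominators cleared. It follows from q-Pascal and the splitting 1 -
    q^(n+1) = (1 - q^(k+1)) + q^(k+1) (1 - q^(n-k)). *)
Lemma gbinom_factorial (n k : nat) : (k <= n)%N ->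
  gbinom n k * (\prod_(0 <= i < k) (1 - q ^+ i.+1)
                * \prod_(0 <= i < n - k) (1 - q ^+ i.+1))
  = \prod_(0 <= i < n) (1 - q ^+ i.+1).
Proof.
elim: n k => [|n IH] [|k] // kn.
- by rewrite !big_nil !mul1r.
- by rewrite big_nil subn0 !mul1r.
rewrite subSS gbinomS mulrDl [RHS]big_nat_recr //=.
have IHk := IH k kn; have [kn'|nk] := ltnP k n; last first.
  have -> : k = n by apply/eqP; rewrite eqn_leq nk andbT.
  rewrite (@gbinom_small n n.+1) // mulr0 mul0r addr0 subnn big_nil.
  rewrite (_ : k = n) in IHk; last by apply/eqP; rewrite eqn_leq nk andbT.
  by rewrite -{}IHk subnn big_nil big_nat_recr //=; ring.
have IHk1 := IH k.+1 kn'.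
rewrite (_ : q ^+ n.+1 = q ^+ k.+1 * q ^+ (n - k.+1).+1); last first.
  by rewrite -exprD; congr (q ^+ _); lia.
rewrite (_ : _ - q ^+ k.+1 * _ = (1 - q ^+ k.+1)
  + q ^+ k.+1 * (1 - q ^+ (n - k.+1).+1)); last by ring.
rewrite mulrDr -[X in X * (1 - q ^+ k.+1)]IHk -[\prod_(0 <= i < n) _]IHk1.
rewrite (_ : n - k = (n - k.+1).+1)%N; last by lia.
by rewrite !big_nat_recr //=; ring.
Qed.

End GaussianBinomial.

(** * Adding and removing the first column of a Young diagram *)

Section FirstColumn.
Local Open Scope nat_scope.

Let geq_trans : transitive geq.
Proof. by move=> a b c /= ab bc; apply: leq_trans bc ab. Qed.

(** A column of length [r] is added if [size s <= r]; otherwise the truncated subtraction appends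
    nothing. *)
Definition addcol (r : nat) (s : seq nat) : seq nat :=
  map S s ++ nseq (r - size s) 1.

Definition delcol (s : seq nat) : seq nat := map predn [seq x <- s | 1 < x].

Lemma addcol_partition r s : is_partition s -> is_partition (addcol r s).
Proof.
move=> /andP[ss s0]; apply/andP; split.
  rewrite (sorted_pairwise geq_trans) pairwise_cat pairwise_map.
  rewrite -[pairwise (relpre _ _) s](@sorted_pairwise _ geq geq_trans s) ss /=.
  apply/andP; split.
    by apply/allrelP => _ y /mapP[x _ ->] /nseqP[-> _].
  by rewrite -(sorted_pairwise geq_trans); elim: (r - size s) => //= -[|k].
by rewrite mem_cat mem_nseq andbF orbF; apply/mapP => -[].
Qed.

Lemma delcol_partition s : is_partition s -> is_partition (delcol s).
Proof.
move=> /andP[ss _]; apply/andP; split.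
  have := sorted_filter geq_trans (leq 2) ss.
  rewrite !(sorted_pairwise geq_trans) pairwise_map.
  by apply: sub_pairwise => x y /=; lia.
by apply/mapP => -[x]; rewrite mem_filter; case: x => [|[]].
Qed.

Lemma addcolK r s : 0 \notin s -> delcol (addcol r s) = s.
Proof.
move=> s0; rewrite /delcol /addcol filter_cat filter_nseq /= cats0.
rewrite filter_map (_ : [seq x <- s | _] = s) ?mapK //.
by apply/all_filterP/allP => -[|x] xs //; rewrite xs in s0.
Qed.

Lemma delcolK s : is_partition s -> addcol (size s) (delcol s) = s.
Proof.
elim: s => //= x s IH /andP[/= ps]; rewrite inE negb_or => /andP[x0 s0].
have {}IH := IH (introT andP (conj (path_sorted ps) s0)).
rewrite /delcol /=; case: ifP => x1.
  by rewrite -[in RHS]IH /addcol /= prednK // ltnW.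
(* A first part equal to 1 forces all later parts to be 1, so [delcol] leaves nothing and [addcol]
   restores the ones. *)
have -> : x = 1 by lia.
have all1 : all (pred1 1) s.
  apply/allP => y ys.
  move: ps => /(order_path_min geq_trans)/allP/(_ y ys) /= yx.
  have : y != 0 by apply: contraNneq s0 => <-.
  lia.
rewrite (all_pred1P _ _ all1) filter_nseq /= /addcol /= size_nseq.
by [].
Qed.

Definition addcolumn (r : nat) (l : intpart) : intpart :=
  Intpart (addcol_partition r _ (valP l)).

Definition delcolumn (l : intpart) : intpart :=
  Intpart (delcol_partition _ (valP l)).

Lemma nparts_size (l : intpart) : nparts l = size l.
Proof.
apply/eqP; rewrite -all_count; apply/allP => -[|x] //.
by case: l => s /= /andP[_ /negbTE ->].
Qed.

Lemma nparts_le_psize (l : intpart) : nparts l <= psize l.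
Proof.
rewrite /nparts /column /psize; elim: (parts l) => //= x s.
by case: x => [|x] /=; lia.
Qed.

Lemma psize0 (l : intpart) : (psize l == 0) = (nparts l == 0).
Proof.
rewrite /nparts /column /psize; elim: (parts l) => //= x s.
by rewrite !addn_eq0 => ->; case: x.
Qed.

Lemma addcolumnK r : cancel (addcolumn r) delcolumn.
Proof.
move=> l; apply: val_inj; apply: addcolK.
by case: l => s /= /andP[].
Qed.

Lemma delcolumnK (l : intpart) : addcolumn (nparts l) (delcolumn l) = l.
Proof.
by apply: val_inj; rewrite /= nparts_size delcolK //; exact: valP.
Qed.

Lemma nparts_delcolumn (l : intpart) : nparts (delcolumn l) <= nparts l.
Proof. by rewrite !nparts_size size_map size_filter count_size. Qed.

Lemma nparts_addcolumn r (l : intpart) :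
  nparts l <= r -> nparts (addcolumn r l) = r.
Proof.
by rewrite !nparts_size /= size_cat size_map size_nseq => /subnKC.
Qed.

Lemma psize_addcolumn r (l : intpart) :
  nparts l <= r -> psize (addcolumn r l) = psize l + r.
Proof.
rewrite nparts_size => lr; rewrite /psize /= sumn_cat sumn_nseq mul1n.
have -> : sumn (map S l) = sumn l + size l.
  by elim: (parts l) => //= x s ->; lia.
by rewrite -addnA subnKC.
Qed.

(** The column is taken nonempty because, when [l] has no parts, the new head is an appended 1. *)
Lemma largest_addcolumn r (l : intpart) :
  largest (addcolumn r.+1 l) = (largest l).+1.
Proof. by rewrite /largest /= /addcol; case: (parts l). Qed.

Lemma column_addcolumn r (l : intpart) i :
  0 < i -> column (addcolumn r l) i.+1 = column l i.
Proof.
move=> i0; rewrite /column count_cat count_nseq count_map /=.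
by rewrite ltnS leqNgt i0 mul0n addn0; apply: eq_count => x /=; rewrite ltnS.
Qed.

Lemma mult_addcolumn r (l : intpart) i :
  0 < i -> mult (addcolumn r l) i.+1 = mult l i.
Proof.
move=> i0; rewrite /mult count_cat count_nseq count_map /=.
by rewrite eqSS eq_sym eqn0Ngt i0 mul0n addn0; apply: eq_count => x /=.
Qed.

(** The parts of [l] are positive, so their successors exceed 1 and only the appended ones count. *)
Lemma mult1_addcolumn r (l : intpart) :
  mult (addcolumn r l) 1 = r - nparts l.
Proof.
rewrite nparts_size /mult count_cat count_nseq count_map /= mul1n.
rewrite (_ : count _ _ = 0) //; apply/eqP; rewrite -leqn0 leqNgt -has_count.
by apply/hasPn => x xl /=; case: x xl => //; case: l => s /= /andP[_ /negbTE ->].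
Qed.

End FirstColumn.

(** * The weight of a partition and its sum over a given size *)

Section Weight.
Variables (R : realType) (p : R).
Hypothesis p1 : 1 < p.

Let p0 : 0 < p. Proof. exact: lt_trans p1. Qed.

Lemma poch_invE m :
  poch p (1 / p) m = \prod_(0 <= i < m) (1 - p^-1 ^+ i.+1).
Proof.
by apply: eq_bigr => i _; rewrite div1r exprVn exprS invfM.
Qed.

Lemma poch_inv_gt0 m : 0 < poch p (1 / p) m.
Proof.
rewrite poch_invE; apply: prodr_gt0 => i _; rewrite subr_gt0.
by rewrite exprn_ilt1 // ?invr_ge0 ?(ltW p0) // invf_lt1.
Qed.

Lemma gbinom_poch n k : (k <= n)%N ->
  gbinom R p^-1 n k
  = poch p (1 / p) n / (poch p (1 / p) k * poch p (1 / p) (n - k)).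
Proof.
move=> kn; have nz m : poch p (1 / p) m != 0 by rewrite gt_eqF ?poch_inv_gt0.
apply: (mulIf (mulf_neq0 (nz k) (nz (n - k)%N))).
by rewrite divfK ?mulf_neq0 // !poch_invE gbinom_factorial.
Qed.

Lemma prod_top_poch d r : (r <= d)%N ->
  \prod_(d - r + 1 <= i < d.+1) (1 - 1 / p ^+ i)
  = poch p (1 / p) d / poch p (1 / p) (d - r).
Proof.
move=> rd; have nz m : poch p (1 / p) m != 0 by rewrite gt_eqF ?poch_inv_gt0.
apply: (mulIf (nz (d - r)%N)); rewrite divfK // !poch_invE addn1 big_add1 /=.
rewrite (big_cat_nat (leq0n _) (leq_subr r d)) /= mulrC; congr (_ * _).
by apply: eq_bigr => i _; rewrite div1r exprVn.
Qed.

Definition partweight (l : intpart) : R :=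
  (p ^+ (\sum_(1 <= i < (largest l).+1) column l i ^ 2)%N
   * \prod_(1 <= i < (largest l).+1) poch p (1 / p) (mult l i))^-1.

(** The part of [Pmass] free of [u]; its sum over the partitions of n is F(d, n). *)
Definition weight (d : nat) (l : intpart) : R :=
  if (nparts l <= d)%N
  then partweight l * (poch p (1 / p) d / poch p (1 / p) (d - nparts l))
  else 0.

Lemma weight_ge0 d l : 0 <= weight d l.
Proof.
rewrite /weight; case: ifP => // _.
rewrite mulr_ge0 ?divr_ge0 ?ltW ?poch_inv_gt0 // invr_gt0.
rewrite mulr_gt0 ?exprn_gt0 //.
by apply: prodr_gt0 => i _; exact: poch_inv_gt0.
Qed.

Lemma partweight_addcolumn r l : (nparts l <= r.+1)%N ->
  partweight (addcolumn r.+1 l)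
  = p^-1 ^+ (r.+1 ^ 2) / poch p (1 / p) (r.+1 - nparts l) * partweight l.
Proof.
move=> lr; rewrite /partweight largest_addcolumn.
have -> : (\sum_(1 <= i < (largest l).+2) column (addcolumn r.+1 l) i ^ 2
    = r.+1 ^ 2 + \sum_(1 <= i < (largest l).+1) column l i ^ 2)%N.
  rewrite big_ltn // -[column _ 1]/(nparts _) nparts_addcolumn // big_add1.
  congr (_ + _)%N; rewrite [LHS]big_nat [RHS]big_nat.
  by apply: eq_bigr => i /andP[i0 _]; rewrite column_addcolumn.
have -> : \prod_(1 <= i < (largest l).+2)
      poch p (1 / p) (mult (addcolumn r.+1 l) i)
    = poch p (1 / p) (r.+1 - nparts l)
      * \prod_(1 <= i < (largest l).+1) poch p (1 / p) (mult l i).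
  rewrite big_ltn // mult1_addcolumn big_add1.
  congr (_ * _); rewrite [LHS]big_nat [RHS]big_nat.
  by apply: eq_bigr => i /andP[i0 _]; rewrite mult_addcolumn.
by rewrite exprD exprVn -!invfM mulrACA.
Qed.

(** With s = [nparts l], the new multiplicity of 1 contributes 1 / (q)_(r+1-s), the denominator
    present in [weight r.+1 l]. Supplying its numerator (q)_(r+1) turns (q)_d / (q)_(d-r-1) into the
    Gaussian binomial. *)
Lemma weight_addcolumn d r l : (nparts l <= r.+1)%N ->
  weight d (addcolumn r.+1 l)
  = p^-1 ^+ (r.+1 ^ 2) * gbinom R p^-1 d r.+1 * weight r.+1 l.
Proof.
move=> lr; rewrite /weight lr nparts_addcolumn //.
have [rd|dr] := leqP r.+1 d; last by rewrite gbinom_small // mulr0 mul0r.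
have nz m : poch p (1 / p) m != 0 by rewrite gt_eqF ?poch_inv_gt0.
rewrite partweight_addcolumn // gbinom_poch //.
by field; rewrite !nz.
Qed.

Lemma psize_eq0 :
  [set l : intpart | psize l = 0%N] = [set Intpart (isT : is_partition [::])].
Proof.
apply/seteqP; split => l /=; last by move->.
move/eqP; rewrite psize0 nparts_size size_eq0 => /eqP l0.
exact: val_inj.
Qed.

(** Each slice collects the partitions with first column of length [r.+1]; what remains after its
    removal has at most [r.+1] parts. *)
Lemma psize_bigcup n :
  [set l : intpart | psize l = n.+1] =
  \bigcup_(r in `I_n.+1) (addcolumn r.+1 @`
    ([set l | psize l = (n - r)%N] `&` [set l | (nparts l <= r.+1)%N])).
Proof.
apply/seteqP; split => l /=.
  move=> ln; have l0 : (0 < nparts l)%N by rewrite lt0n -psize0 ln.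
  have lS := nparts_le_psize l.
  have dl := nparts_delcolumn l.
  exists (nparts l).-1; first by rewrite /=; lia.
  exists (delcolumn l); last by rewrite prednK // delcolumnK.
  rewrite /= prednK //; split => //.
  by have := psize_addcolumn _ _ dl; rewrite delcolumnK ln; lia.
by move=> [r /= rn [m [mn mr] <-]]; rewrite psize_addcolumn // mn; lia.
Qed.

(* The factor [c] makes the induction go through without a scaling lemma for
   [esum]. *)
Lemma esum_weight (c : R) n d : 0 <= c -> (0 < d)%N ->
  \esum_(l in [set l : intpart | psize l = n]) (c * weight d l)%:E
  = (c * (p^-1 ^+ n * gbinom R p^-1 (d + n - 1) n))%:E.
Proof.
move=> c0 d0; elim/ltn_ind: n c d c0 d0 => n IH c d c0 d0.
have nneg l : (0 <= (c * weight d l)%:E)%E.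
  by rewrite lee_fin mulr_ge0 // weight_ge0.
case: n => [|n] in IH *.
  rewrite psize_eq0 esum_set1 //.
  rewrite gbinom0 /weight /partweight /largest /nparts /column /=.
  rewrite subn0 !big_geq // expr0 divff; last by rewrite gt_eqF ?poch_inv_gt0.
  by rewrite !mulr1 invr1 ?mulr1.
rewrite (psize_bigcup n) esum_bigcup; last 2 first.
(* Disjointness: the number of parts recovers the column length. *)
- move=> i j _ _ [_ [[l [_ li] <-] [m [_ mj]]]].
  by move=> /(congr1 nparts); rewrite !nparts_addcolumn // => -[].
- by move=> l _; exact: nneg.
pose t r := p^-1 ^+ (r.+1 ^ 2) * gbinom R p^-1 d r.+1.
have gb_ge0 m k : 0 <= gbinom R p^-1 m k.
  have [km|mk] := leqP k m; last by rewrite gbinom_small.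
  by rewrite gbinom_poch // divr_ge0 ?mulr_ge0 // ltW ?poch_inv_gt0.
have t0 r : 0 <= t r by rewrite mulr_ge0 ?exprn_ge0 ?invr_ge0 ?(ltW p0).
under eq_esum => r /= rn.
  rewrite esum_image; last by move=> l m _ _; exact: (can_inj (addcolumnK _)).
  (* The bound [nparts l <= r.+1] moves into the summand, where it agrees with the vanishing of
     [weight r.+1], so the sum again runs over all partitions of n - r. *)
  rewrite esum_mkcondr.
  under eq_esum => l _.
    rewrite (_ : (if _ then _ else _) = (c * t r * weight r.+1 l)%:E);
      last first.
      case: ifPn => [/set_mem|/negP lr]; first
        by move=> /= ?; rewrite weight_addcolumn // mulrA.
      rewrite /weight ifF ?mulr0 //; apply/negP => h.
      by apply: lr; exact: mem_set.
    over.
  (* The induction hypothesis is used with [c * t r] for [c] and [r.+1] for [d]. *)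
  rewrite IH ?ltnS ?leq_subr ?(mulr_ge0 c0 (t0 r)) //.
  over.
rewrite /= esum_fset //; last first.
  by move=> r _; rewrite lee_fin !mulr_ge0 ?exprn_ge0 ?invr_ge0 ?(ltW p0).
rewrite -fsbig_ord sumEFin; congr (_%:E).
(* In q-Vandermonde for n + d, the term j = 0 contains [n choose n + 1] = 0; the term j = r + 1 is
   that of first-column length r + 1. *)
rewrite (_ : d + n.+1 - 1 = n + d)%N; last by lia.
rewrite gbinom_Vandermonde big_nat_recl // big_mkord subn0 gbinom_small //.
rewrite !mul0r add0r !mulr_sumr; apply: eq_bigr => r _.
have rn : (r <= n)%N by rewrite -ltnS.
rewrite (_ : r.+1 + (n - r) - 1 = n)%N; last by lia.
rewrite subSS (_ : n + r.+1 - n.+1 = r)%N; last by lia.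
have e : p^-1 ^+ (r.+1 ^ 2) * p^-1 ^+ (n - r) = p^-1 ^+ n.+1 * p^-1 ^+ (r.+1 * r).
  by rewrite -!exprD; congr (_ ^+ _); lia.
transitivity (c * (p^-1 ^+ (r.+1 ^ 2) * p^-1 ^+ (n - r))
  * (gbinom R p^-1 d r.+1 * gbinom R p^-1 n (n - r))); first by rewrite /t; ring.
by rewrite e; ring.
Qed.

End Weight.

Theorem theorem2p4 (R : realType) (p u : R) (d : nat)
    (hp : 1 < p) (hu0 : 0 < u) (hup : u < p) (hd : (0 < d)%N) (n : nat) :
  Pmeas p u d [set l : intpart | psize l = n] =
  (u ^+ n / p ^+ n
   * (poch p (u / p) d * poch p (1 / p) (d + n - 1)
      / (poch p (1 / p) (d - 1) * poch p (1 / p) n)))%:E.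
Proof.
have p0 : 0 < p by exact: lt_trans hp.
have prodE : \prod_(1 <= i < d.+1) (1 - u / p ^+ i) = poch p (u / p) d.
  by rewrite big_add1; apply: eq_bigr => i _; rewrite exprS invfM mulrA.
(* This constant, the factor of [Pmass] carrying [u], is the [c] of [esum_weight]; u < p makes every
   1 - u / p^(i+1) nonnegative. *)
have c0 : 0 <= u ^+ n * poch p (u / p) d.
  rewrite mulr_ge0 ?exprn_ge0 ?(ltW hu0) //; apply: prodr_ge0 => i _.
  rewrite subr_ge0 -mulrA -invfM -exprS ler_pdivrMr ?exprn_gt0 // mul1r.
  by rewrite (le_trans (ltW hup)) // exprS ler_peMr ?exprn_ege1 // ltW.
rewrite /Pmeas; under eq_esum => l ln.
  rewrite (_ : Pmass _ _ _ _ = u ^+ n * poch p (u / p) d * weight R p d l).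
    over.
  rewrite /Pmass /weight; case: ifP => [ld|_]; last by rewrite mulr0.
  by rewrite prodE prod_top_poch // -/(partweight R p l) -ln; ring.
(* Positivity of [d] gives n <= d + n - 1, as the quotient formula requires. *)
rewrite (esum_weight R p hp) // gbinom_poch //; last by lia.
rewrite (_ : d + n - 1 - n = d - 1)%N; last by lia.
by rewrite exprVn [poch _ _ n * _]mulrC; congr (_%:E); ring.
Qed.
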